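(* Let $g:\mathbb{Z}_{\ge0}\to\mathbb{C}$ be an arbitrary sequence and define formally, for $n\ge 1$, \[ f(n)=\sum_{k\ge0}\sum_{l=0}^{2^{k}-1}g\left(2^{k}n+l\right). \] Then, as identities of formal sums, $g(n)=f(n)-f(2n)-f(2n+1)$ for every $n\ge1$, and \[ \sum_{n\ge1}s_{2}(n)g(n)=\sum_{n\ge0}f(2n+1)=\sum_{n,k\ge0}\sum_{l=0}^{2^{k}-1}g\left(2^{k+1}n+2^{k}+l\right). \]
   Context: $s_2(n)$ is the number of ones in the binary expansion of $n$. ''Identity of formal sums'' means: when both sides are expanded as (possibly infinite) formal linear combinations of the symbols $g(m)$, $m\ge0$, each symbol $g(m)$ occurs with the same (finite) coefficient on both sides. *)

(* Defs.v *)
From HB Require Import structures.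
From mathcomp Require Import all_boot all_order all_algebra.
From mathcomp Require Import all_classical.

Set Implicit Arguments.
Unset Strict Implicit.
Unset Printing Implicit Defensive.

Import Order.TTheory GRing.Theory Num.Theory.
Local Open Scope classical_set_scope.
Local Open Scope ring_scope.

(* A possibly infinite formal linear combination of the symbols g(m), m >= 0,
   given by its coefficients: u m is the coefficient of g(m) in u.  Addition
   and opposite are pointwise.  All coefficients that occur are integers. *)
Notation formal := (nat -> int).

(* The symbol g(m) itself, as a formal linear combination. *)
Definition g (m : nat) : formal := fun j => (j == m)%:R.

(* An infinite sum of formal linear combinations makes sense when each symbol
   occurs in only finitely many of the summands. *)
Definition locally_finite (I : choiceType) (D : set I) (F : I -> formal) :
    Prop :=
  forall m : nat, finite_set [set i | D i /\ F i m != 0].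

(* Meaningful only if locally_finite D F: the finitely supported sum is 0 by
   convention at a symbol occurring in infinitely many summands. *)
Definition fsum (I : choiceType) (D : set I) (F : I -> formal) : formal :=
  fun m => \sum_(i \in D) F i m.

Definition fblock (n k : nat) : formal :=
  \sum_(0 <= l < 2 ^ k) g (2 ^ k * n + l)%N.

(* Not locally finite for n = 0, where g(0) occurs in every block. *)
Definition f (n : nat) : formal := fsum [set: nat] (fblock n).

(* The i-th binary digit of n is odd (n %/ 2 ^ i); it is 0 for i >= n because
   n < 2 ^ n. *)
Definition s2 (n : nat) : nat := (\sum_(0 <= i < n) odd (n %/ 2 ^ i))%N.

(* Main.v *)
(** The coefficient of [g m] in the block [(n, k)] is the indicator of
    [m %/ 2 ^ k = n]: the blocks containing [m] are those indexed by the prefixes of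
    its binary expansion. Splitting the prefixes of length [k] by their last
    digit gives the recurrence, and the blocks with odd [n] containing [m] are in
    bijection with the ones in the binary expansion of [m]. *)
Require Import Defs.
From HB Require Import structures.
From mathcomp Require Import all_boot all_order all_algebra.
From mathcomp Require Import all_classical.

Set Implicit Arguments.
Unset Strict Implicit.
Unset Printing Implicit Defensive.

Import Order.TTheory GRing.Theory Num.Theory.
Local Open Scope classical_set_scope.
Local Open Scope ring_scope.

Lemma locally_finite_seq (I : choiceType) (D : set I) (F : I -> formal)
    (s : nat -> seq I) :
    (forall m i, D i -> F i m != 0 -> i \in s m) ->
  locally_finite D F.
Proof.
move=> Fs m; apply: (sub_finite_set _ (finite_seq (s m))) => i [Di Fi].
exact: Fs.
Qed.

(** The list need only contain the support at [m]: extra indices contribute zero. This allows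
    convenient ranges below instead of exact supports. *)
Lemma fsum_seq (I : choiceType) (D : set I) (F : I -> formal) m (s : seq I) :
    uniq s -> (forall i, i \in s -> D i) ->
    (forall i, D i -> F i m != 0 -> i \in s) ->
  fsum D F m = \sum_(i <- s) F i m.
Proof.
move=> us sD Fs; rewrite /fsum (fsbigE s) //.
  rewrite big_seq_cond [RHS]big_seq_cond; apply: eq_bigl => i.
  by case: (boolP (i \in s)) => //= /sD Di; rewrite mem_set.
by move=> i Di; apply: contraNeq; exact: Fs.
Qed.

Lemma sum_indicator (I : eqType) (s : seq I) (a : I) : uniq s ->
  \sum_(i <- s) (i == a)%:R = (a \in s)%:R :> int.
Proof.
move=> us; rewrite -count_uniq_mem // -sum1_count natr_sum [RHS]big_mkcond.
by apply: eq_bigr => i _ /=; case: eqP.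
Qed.

(** By uniqueness of Euclidean division by [2 ^ k], only [l = m %% 2 ^ k] can contribute, and it
    does so exactly when the quotient is [n]. *)
Lemma fblockE n k m : fblock n k m = (m %/ 2 ^ k == n)%N%:R.
Proof.
have p0 : (0 < 2 ^ k)%N by rewrite expn_gt0.
rewrite /fblock fct_sumE /g.
rewrite (eq_big_nat _ _ (F2 := fun l =>
  (m %/ 2 ^ k == n)%N%:R * (l == m %% 2 ^ k)%N%:R)); last first.
  move=> l /andP[_ lk]; rewrite -natrM mulnb; congr (nat_of_bool _)%:R.
  apply/eqP/andP => [->|[/eqP <- /eqP ->]].
    by rewrite mulnC divnMDl // modnMDl divn_small // modn_small // addn0.
  by rewrite mulnC -divn_eq.
rewrite -mulr_sumr sum_indicator ?iota_uniq // mem_index_iota ltn_mod p0.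
by rewrite mulr1.
Qed.

Lemma fblock_supp n k m : (1 <= n)%N -> fblock n k m != 0 ->
  (n <= m)%N && (k < m)%N.
Proof.
rewrite fblockE pnatr_eq0 eqb0 negbK => n1 /eqP mkn; rewrite -{1}mkn leq_div /=.
(* A nonzero quotient forces [2 ^ k <= m], and [k < 2 ^ k]. *)
apply: leq_trans (ltn_expl k (ltnSn 1)) _.
by rewrite -[(2 ^ k)%N]mul1n -leq_divRL ?expn_gt0 // mkn.
Qed.

(** The cutoff [N] is left free so that sums for different [n] can be truncated at different
    lengths. *)
Lemma fE n m N : (1 <= n)%N -> (m <= N)%N ->
  f n m = \sum_(0 <= k < N) (m %/ 2 ^ k == n)%N%:R.
Proof.
move=> n1 mN; rewrite /f (fsum_seq (s := index_iota 0 N)) ?iota_uniq //.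
  by apply: eq_bigr => k _; rewrite fblockE.
move=> k _ /fblock_supp-/(_ n1) /andP[_ km].
by rewrite mem_index_iota (leq_trans km).
Qed.

Lemma f_supp n m : (1 <= n)%N -> f n m != 0 -> (n <= m)%N.
Proof.
move=> n1; rewrite (fE n1 (leqnn m)); apply: contraNT => nm.
rewrite big1 // => k _; rewrite -fblockE; apply: contraNeq nm.
by case/fblock_supp/andP.
Qed.

Lemma f_rec n : (1 <= n)%N -> g n = f n - f (2 * n)%N - f (2 * n + 1)%N.
Proof.
move=> n1; apply/funext => m; rewrite -addrA -opprD !fctE.
have n2 : (1 <= 2 * n)%N by rewrite muln_gt0.
(* [f n] gets one more term than the other two: its term [k = 0] is the coefficient of [g n], and
   the remaining terms, shifted by one, match theirs. *)
rewrite (fE n1 (leqnSn m)) (fE n2 (leqnn m)) (fE _ (leqnn m)) ?addn1 //.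
rewrite big_nat_recl // expn0 divn1 -big_split /=.
rewrite [X in _ + X - _](eq_bigr (fun k =>
   (m %/ 2 ^ k == 2 * n)%N%:R + (m %/ 2 ^ k == (2 * n).+1)%N%:R)) ?addrK //.
move=> k _; rewrite expnSr divnMA; move: (m %/ 2 ^ k)%N => a.
rewrite -natrD; congr (_%:R); rewrite divn2 mul2n.
have odd_even b c : (b.*2.+1 == c.*2)%N = false.
  by apply/eqP => /(congr1 odd); rewrite /= !odd_double.
(* The half of [a] is [n] iff [a] is [2n] or [2n + 1]; the parity of [a] rules out one of the
   two. *)
rewrite -{2 3}(odd_double_half a); case: (odd a); rewrite /= ?add1n ?add0n.
  by rewrite odd_even eqSS (inj_eq double_inj).
by rewrite [(_ == _.+1)%N]eq_sym odd_even addn0 (inj_eq double_inj).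
Qed.

(** For odd [a] the only contributing index is [a./2], which lies in range because
    [a./2 < a <= N]. *)
Lemma big_odd (a N : nat) : (a <= N)%N ->
  \sum_(0 <= n < N) (a == 2 * n + 1)%N%:R = (odd a)%:R :> int.
Proof.
move=> aN; case: (boolP (odd a)) => oa; last first.
  rewrite big1 // => n _; case: eqP => // e; move: oa.
  by rewrite e addn1 mul2n /= odd_double.
rewrite (eq_bigr (fun n => (n == a./2)%:R)) => [|n _].
  rewrite sum_indicator ?iota_uniq // mem_index_iota.
  rewrite (leq_trans _ aN) // -{2}(odd_double_half a) oa.
  by rewrite -addnn add1n ltnS leq_addr.
rewrite -{1}(odd_double_half a) oa addn1 add1n eqSS mul2n (inj_eq double_inj).
by rewrite eq_sym.
Qed.

(** After exchanging the sums, the inner sum for fixed [k] tests whether [m %/ 2 ^ k] is odd, which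
    is the [k]-th binary digit of [m]. *)
Lemma sum_odd_f m :
  \sum_(0 <= n < m) f (2 * n + 1)%N m = (s2 m)%:R.
Proof.
under eq_bigr do rewrite (fE (ltn_addl _ (ltnSn 0)) (leqnn m)).
rewrite exchange_big /s2 natr_sum; apply: eq_bigr => k _.
by rewrite big_odd // leq_div.
Qed.

Lemma odd_blockE (p : nat * nat) :
  \sum_(0 <= l < 2 ^ p.2) g (2 ^ p.2.+1 * p.1 + 2 ^ p.2 + l)%N =
  fblock (2 * p.1 + 1)%N p.2.
Proof.
apply: eq_bigr => l _; congr (g (_ + l)).
by rewrite mulnDr muln1 mulnA -expnSr.
Qed.

Lemma odd_f_supp n m : f (2 * n + 1)%N m != 0 -> n \in index_iota 0 m.
Proof.
rewrite mem_index_iota /= => /f_supp; rewrite addn1 => /(_ isT).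
by apply: leq_trans; rewrite ltnS leq_pmull.
Qed.

Lemma fsum_odd_f m :
  fsum [set: nat] (fun n => f (2 * n + 1)%N) m =
  \sum_(0 <= n < m) f (2 * n + 1)%N m.
Proof.
rewrite (fsum_seq (s := index_iota 0 m)) ?iota_uniq // => n _.
exact: odd_f_supp.
Qed.

Lemma g_mulrn_supp n k m : (g n *+ k) m != 0 -> n = m.
Proof.
rewrite natmulfctE /g; case: (m =P n) => [-> //|_].
by rewrite mulr0n mul0rn.
Qed.

Lemma odd_block_supp (p : nat * nat) m : fblock (2 * p.1 + 1)%N p.2 m != 0 ->
  p \in [seq (n, k) | n <- index_iota 0 m, k <- index_iota 0 m].
Proof.
case: p => n k /=; rewrite addn1 => /fblock_supp-/(_ isT) /andP[nm km].
apply/allpairsP; exists (n, k); rewrite !mem_index_iota km /=; split => //.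
by apply: leq_trans nm; rewrite ltnS leq_pmull.
Qed.

Theorem theorem22 :
  [/\ (forall n : nat, (1 <= n)%N -> locally_finite [set: nat] (fblock n)),
      (forall n : nat, (1 <= n)%N ->
         g n = f n - f (2 * n)%N - f (2 * n + 1)%N) &
      [/\ locally_finite [set n : nat | (1 <= n)%N] (fun n => g n *+ s2 n),
          locally_finite [set: nat] (fun n => f (2 * n + 1)%N),
          locally_finite [set: nat * nat] (fun p =>
            \sum_(0 <= l < 2 ^ p.2) g (2 ^ p.2.+1 * p.1 + 2 ^ p.2 + l)%N),
          fsum [set n : nat | (1 <= n)%N] (fun n => g n *+ s2 n) =
            fsum [set: nat] (fun n => f (2 * n + 1)%N) &
          fsum [set: nat] (fun n => f (2 * n + 1)%N) =
            fsum [set: nat * nat] (fun p =>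
              \sum_(0 <= l < 2 ^ p.2) g (2 ^ p.2.+1 * p.1 + 2 ^ p.2 + l)%N)]].
Proof.
split; [|exact: f_rec|split].
- move=> n n1; apply: (locally_finite_seq (s := index_iota 0)) => m k _.
  by case/(fblock_supp n1)/andP => _; rewrite mem_index_iota.
- apply: (locally_finite_seq (s := fun m => [:: m])) => m n _.
  by move=> /g_mulrn_supp ->; rewrite mem_head.
- by apply: (locally_finite_seq (s := index_iota 0)) => m n _ /odd_f_supp.
- under eq_fun do rewrite odd_blockE.
  apply: locally_finite_seq => m p _; exact: odd_block_supp.
- apply/funext => m; rewrite fsum_odd_f sum_odd_f.
  (* The symbol [g 0] is not indexed on the left, so its coefficient there is an empty sum, in
     agreement with [s2 0 = 0]. *)
  have [->|m0] := posnP m.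
    rewrite (fsum_seq (s := [::])) ?big_nil /s2 ?big_nil // => n n1.
    by move=> /g_mulrn_supp n0; rewrite n0 in n1.
  rewrite (fsum_seq (s := [:: m])) //= ?big_seq1 ?natmulfctE /g ?eqxx //.
    by move=> n; rewrite inE => /eqP ->.
  by move=> n _ /g_mulrn_supp ->; rewrite mem_head.
- apply/funext => m; rewrite fsum_odd_f.
  under [in RHS]eq_fun do rewrite odd_blockE.
  rewrite (fsum_seq _ _ (fun p _ => @odd_block_supp p m)) //; last first.
    by rewrite allpairs_uniq ?iota_uniq // => -[? ?] [? ?].
  (* Over the square of pairs below [m], the inner sum over [k] is [f (2 * n + 1)] at [m], truncated
     at [m]. *)
  rewrite big_allpairs; apply: eq_bigr => n _.
  rewrite (fE (ltn_addl _ (ltnSn 0)) (leqnn m)).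
  by apply: eq_bigr => k _; rewrite fblockE.
Qed.
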